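(* Let $\mathcal{C}$ be a commutative ring with unity, let $n\geq 1$, $k\geq 1$, and let $n_1,\ldots,n_k$ be positive integers with $n_1+\cdots+n_k=n$. Let $\mathcal{T}=\mathcal{T}(n_1,n_2,\ldots,n_k)\subseteq M_n(\mathcal{C})$ be the corresponding block upper triangular matrix algebra, and let $\mathcal{M}$ be a $2$-torsion free unital $\mathcal{T}$-bimodule. Suppose that $D:\mathcal{T}\rightarrow\mathcal{M}$ is a Jordan derivation. Then there exist a derivation $d:\mathcal{T}\rightarrow\mathcal{M}$ and an antiderivation $\alpha:\mathcal{T}\rightarrow\mathcal{M}$ such that $D=d+\alpha$ and $\alpha(\mathcal{D}(n_1,n_2,\ldots,n_k))=\{0\}$. Moreover, $d$ and $\alpha$ are uniquely determined (i.e. there is exactly one pair $(d,\alpha)$ consisting of a derivation $d$ and an antiderivation $\alpha$ from $\mathcal{T}$ to $\mathcal{M}$ with $D=d+\alpha$ and $\alpha(\mathcal{D}(n_1,\ldots,n_k))=\{0\}$).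
   Context: Throughout, $\mathcal{C}$ is a commutative ring with unity and $M_n(\mathcal{C})$ is the $\mathcal{C}$-algebra of all $n\times n$ matrices over $\mathcal{C}$. Block upper triangular matrix algebra: for positive integers $n_1,\ldots,n_k$ with $n_1+\cdots+n_k=n$, $\mathcal{T}(n_1,\ldots,n_k)$ is the subalgebra of $M_n(\mathcal{C})$ of all matrices of the form $$X=\begin{pmatrix} X_{11} & X_{12} & \cdots & X_{1k}\\ 0 & X_{22} & \cdots & X_{2k}\\ \vdots & \vdots & \ddots & \vdots\\ 0&0&\cdots & X_{kk}\end{pmatrix},$$ where $X_{ij}$ is an $n_i\times n_j$ matrix over $\mathcal{C}$. (For $k=1$ it is $M_n(\mathcal{C})$; for $k=n$ with all $n_i=1$ it is the algebra $T_n(\mathcal{C})$ of upper triangular matrices.) Block diagonal subalgebra: let $E_{ij}$ denote the matrix units and $E_l=E_{ll}$. Put $F_1=\sum_{i=1}^{n_1}E_i$ and $F_j=\sum_{i=1}^{n_j}E_{i+n_1+\cdots+n_{j-1}}$ for $2\leq j\leq k$. With $\mathcal{T}=\mathcal{T}(n_1,\ldots,n_k)$, define $$\mathcal{D}(n_1,\ldots,n_k)=F_1\mathcal{T}F_1+\cdots+F_k\mathcal{T}F_k .$$ Maps: let $\mathcal{A}$ be an algebra over $\mathcal{C}$ and $\mathcal{M}$ an $\mathcal{A}$-bimodule (over $\mathcal{C}$: $\mathcal{M}$ is a $\mathcal{C}$-module and the left and right actions of $\mathcal{A}$ are $\mathcal{C}$-bilinear). A $\mathcal{C}$-linear map $D:\mathcal{A}\to\mathcal{M}$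 is - a Jordan derivation if $D(ab+ba)=D(a)b+aD(b)+D(b)a+bD(a)$ for all $a,b\in\mathcal{A}$; - a derivation if $D(ab)=D(a)b+aD(b)$ for all $a,b\in\mathcal{A}$; - an antiderivation if $D(ab)=D(b)a+bD(a)$ for all $a,b\in\mathcal{A}$. All derivations, antiderivations and Jordan derivations are $\mathcal{C}$-linear. The bimodule $\mathcal{M}$ is unital if the identity of $\mathcal{A}$ acts as the identity on both sides, and $2$-torsion free if $2m=0$ with $m\in\mathcal{M}$ implies $m=0$. *)

(* Defs.v *)
From HB Require Import structures.
From mathcomp Require Import all_boot all_order all_algebra.

Set Implicit Arguments.
Unset Strict Implicit.
Unset Printing Implicit Defensive.

Import GRing.Theory.
Local Open Scope ring_scope.

Section BlockTriangular.

Variables (C : comPzRingType) (k : nat) (p : 'I_k -> nat).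

Local Notation Mn := 'M[C]_(\sum_(i < k) p i).

Definition block_trig : {pred Mn} :=
  fun X => [forall i : 'I_k, forall j : 'I_k, (j < i)%N ==> (submxblock X i j == 0)].

Lemma block_trigP (X : Mn) :
  reflect (forall i j : 'I_k, (j < i)%N -> submxblock X i j = 0)
          (X \in block_trig).
Proof.
apply: (iffP forallP) => h i => [j ji|].
  by move/forallP: (h i) => /(_ j) /implyP /(_ ji) /eqP.
by apply/forallP=> j; apply/implyP=> ji; rewrite h.
Qed.

Fact block_trig_subring : subring_closed block_trig.
Proof.
split=> [|X Y /block_trigP hX /block_trigP hY
         |X Y /block_trigP hX /block_trigP hY]; apply/block_trigP=> i j ji.
- apply/matrixP=> s t; rewrite !mxE -val_eqE /= tagnat.eq_Rank.
  suff /negbTE -> : i != j by [].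
  by rewrite neq_ltn ji orbT.
- by rewrite submxblockB hX // hY // subr0.
- rewrite -[X]submxblockK -[Y]submxblockK -mulmxE mul_mxblock mxblockK.
  apply: big1 => l _; case: (ltnP l i) => li; first by rewrite hX // mul0mx.
  by rewrite hY ?mulmx0 // (leq_trans ji).
Qed.

HB.instance Definition _ :=
  GRing.isSubringClosed.Build Mn block_trig block_trig_subring.

Fact block_trig_scale (c : C) (X : Mn) :
  X \in block_trig -> c *: X \in block_trig.
Proof.
move=> /block_trigP hX; apply/block_trigP=> i j ji.
apply/matrixP=> s t; move/matrixP/(_ s t): (hX _ _ ji).
by rewrite !mxE => ->; rewrite mulr0.
Qed.

HB.instance Definition _ :=
  GRing.isScaleClosed.Build C Mn block_trig block_trig_scale.

Record blockTrig := BlockTrig {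
  blockTrig_val :> Mn;
  _ : blockTrig_val \in block_trig
}.

HB.instance Definition _ := [isSub for blockTrig_val].
HB.instance Definition _ := [Choice of blockTrig by <:].
HB.instance Definition _ :=
  GRing.SubChoice_isSubPzRing.Build Mn block_trig blockTrig block_trig_subring.
HB.instance Definition _ := [SubZmodule_isSubLmodule of blockTrig by <:].

(* With these, blockTrig is a C-algebra; it is not declared an algType, as that
   would require 1 != 0 and exclude the zero ring C. *)
Lemma blockTrig_scalerAl (c : C) (X Y : blockTrig) : c *: (X * Y) = (c *: X) * Y.
Proof. by apply: val_inj; apply: scalemxAl. Qed.

Lemma blockTrig_scalerAr (c : C) (X Y : blockTrig) : c *: (X * Y) = X * (c *: Y).
Proof. by apply: val_inj; apply: scalemxAr. Qed.

(* tagnat.Rank j i is the index p 0 + ... + p (j - 1) + i. *)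
Definition block_idem (j : 'I_k) : Mn :=
  \sum_(i < p j) delta_mx (tagnat.Rank j i) (tagnat.Rank j i).

Definition block_diagonal (X : blockTrig) : Prop :=
  exists Y : 'I_k -> blockTrig,
    X = \sum_(j < k) (block_idem j *m Y j *m block_idem j) :> Mn.

End BlockTriangular.

(* Bimodules need not be unital: the action of 1 is only constrained by
   unital_bimodule below. *)
HB.mixin Record isBimodule (C : comPzRingType) (k : nat) (p : 'I_k -> nat) M
    of GRing.Lmodule C M := {
  lact : blockTrig C p -> M -> M;
  ract : M -> blockTrig C p -> M;
  lact_linearl : forall m : M, linear (fun a => lact a m);
  lact_linearr : forall a, linear (lact a);
  ract_linearl : forall a, linear (fun m : M => ract m a);
  ract_linearr : forall m : M, linear (ract m);
  lactA : forall a b (m : M), lact (a * b) m = lact a (lact b m);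
  ractA : forall (m : M) a b, ract m (a * b) = ract (ract m a) b;
  lractA : forall a (m : M) b, ract (lact a m) b = lact a (ract m b)
}.

#[short(type="bimodType")]
HB.structure Definition Bimodule (C : comPzRingType) (k : nat)
    (p : 'I_k -> nat) :=
  {M of GRing.Lmodule C M & isBimodule C k p M}.

Declare Scope bimod_scope.
Notation "a *L m" := (lact a m) (at level 40, left associativity) : bimod_scope.
Notation "m *R a" := (ract m a) (at level 40, left associativity) : bimod_scope.

Section Maps.

Local Open Scope bimod_scope.

Variables (C : comPzRingType) (k : nat) (p : 'I_k -> nat) (M : bimodType C p).

Local Notation T := (blockTrig C p).

Definition unital_bimodule : Prop :=
  forall m : M, (1 : T) *L m = m /\ m *R (1 : T) = m.

Definition two_torsion_free : Prop := forall m : M, m *+ 2 = 0 -> m = 0.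

Definition jordan_derivation (D : T -> M) : Prop :=
  linear D /\
  forall a b : T, D (a * b + b * a) = D a *R b + a *L D b + D b *R a + b *L D a.

Definition derivation (d : T -> M) : Prop :=
  linear d /\ forall a b : T, d (a * b) = d a *R b + a *L d b.

Definition antiderivation (h : T -> M) : Prop :=
  linear h /\ forall a b : T, h (a * b) = h b *R a + b *L h a.

End Maps.

Arguments unital_bimodule {C k p} M.
Arguments two_torsion_free {C k p} M.

(* Main.v *)
From HB Require Import structures.
Require Import Defs.
From mathcomp Require Import all_boot all_order all_algebra.

Set Implicit Arguments.
Unset Strict Implicit.
Unset Printing Implicit Defensive.

Import GRing.Theory.
Local Open Scope ring_scope.
Local Open Scope bimod_scope.

(** Write e_ij for the matrix units of the algebra T and e_i for e_ii. The
    Jordan identity, evaluated on a pair of matrix units and multiplied by some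
    e_s on the left and some e_t on the right ([jordan_corner]), becomes an
    identity with few surviving terms; everything below comes from it.

    Up to an inner derivation D kills all the e_i, and then e_ij = e_i e_ij +
    e_ij e_i = e_ij e_j + e_j e_ij forces D(e_ij) to lie in e_i M e_j + e_j M e_i
    for i <> j. A derivation would only have the component in e_i M e_j, an
    antiderivation only the one in e_j M e_i. So alpha ([anti_part]) sends e_ij to
    v_ij = e_j D(e_ij) e_i for i <> j and e_i to 0. An inner derivation
    contributes nothing to v_ij, so D need not be normalized to define alpha.

    The elements v_ij are very degenerate: they are killed by all off-diagonal
    units, v_st e_ij = 0 and e_ij v_st = 0 for i <> j ([swapped_mulr_eq0],
    [swapped_mull_eq0]), and v_il = 0 as soon as e_il = e_ij e_jl with j distinct
    from i and l ([swapped_intermediate_eq0]). Hence on two off-diagonal units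
    both sides of the antiderivation identity vanish, and with a factor e_i it is
    immediate ([antiderivation_anti_part]). If i and j are in the same block, then
    e_ji is in T and v_ij = (v_ij e_ij) e_ji = 0, so alpha vanishes on the
    block diagonal ([anti_part_block_diagonal]).

    The difference D - alpha is again a Jordan derivation. Subtracting an inner
    derivation ([jordan_inner_idem]) makes it send each e_ij into e_i M e_j.
    The two halves of the Jordan identity for e_ij and e_st then lie in
    e_i M e_t and e_s M e_j, and can be separated ([derivation_of_corner]).

    Uniqueness: two decompositions differ by a map h that is both a derivation
    and an antiderivation and kills every e_i. Then for i <> j,
    h(e_ij) = h(e_ij) e_j because h is a derivation, and h(e_ij) = h(e_ij) e_i
    because it is an antiderivation, so h(e_ij) = 0. *)

(** * Matrix units of the block triangular algebra *)

Section Units.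
Variables (C : comPzRingType) (k : nat) (p : 'I_k -> nat).
Local Notation T := (blockTrig C p).
Local Notation I := 'I_(\sum_(i < k) p i).
Implicit Types (i j l : I) (X : T).

Definition blk i : 'I_k := tagnat.sig1 i.

Lemma block_trig_entryP (X : 'M[C]_(\sum_(i < k) p i)) :
  X \in @block_trig C k p <-> forall i j, (blk j < blk i)%N -> X i j = 0.
Proof.
split=> [/block_trigP h i j ji|h].
  move/matrixP: (h _ _ ji) => /(_ (tagnat.sig2 i) (tagnat.sig2 j)).
  by rewrite !mxE !tagnat.sig2K.
apply/block_trigP=> i j ji; apply/matrixP=> s t; rewrite !mxE.
by apply: h; rewrite /blk !tagnat.Rank1K.
Qed.

Definition unit_mx i j : 'M[C]_(\sum_(i < k) p i) :=
  if (blk i <= blk j)%N then delta_mx i j else 0.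

Lemma unit_mx_trig i j : unit_mx i j \in @block_trig C k p.
Proof.
rewrite /unit_mx; case: ifP => ij; last exact: rpred0.
apply/block_trig_entryP=> s t ts; rewrite mxE.
by case: eqP => // ?; case: eqP => // ?; subst s t; rewrite ltnNge ij in ts.
Qed.

(** Cutting off the units outside the algebra to 0 makes [munit] a total
    family, so that sums over it range over all pairs of indices. *)
Definition munit i j : T := BlockTrig (unit_mx_trig i j).
Local Notation E := munit.

Lemma munit_mul i j l : (blk i <= blk j)%N -> (blk j <= blk l)%N -> E i j * E j l = E i l.
Proof.
move=> ij jl; apply: val_inj => /=.
by rewrite /unit_mx ij jl (leq_trans ij jl) -mulmxE mul_delta_mx.
Qed.

Lemma munit_mul0 i j s t : j != s -> E i j * E s t = 0.
Proof.
move=> js; apply: val_inj => /=; rewrite /unit_mx.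
by do 2!case: ifP => _; rewrite ?mul0r ?mulr0 // -mulmxE mul_delta_mx_0.
Qed.

Lemma munit_gt i j : (blk j < blk i)%N -> E i j = 0.
Proof. by move=> ij; apply: val_inj; rewrite /= /unit_mx leqNgt ij. Qed.

Lemma munit_sum X : X = \sum_i \sum_j X i j *: E i j.
Proof.
apply: val_inj; rewrite [LHS]matrix_sum_delta (raddf_sum val).
apply: eq_bigr => i _; rewrite (raddf_sum val); apply: eq_bigr => j _ /=.
rewrite /unit_mx; case: leqP => // ij; rewrite scaler0.
by have /block_trig_entryP -> := valP X; rewrite ?scale0r.
Qed.

Lemma sum_munit1 : \sum_i E i i = 1.
Proof.
rewrite [RHS]munit_sum; apply: eq_bigr => i _.
rewrite (bigD1 i) //= [X in _ + X]big1 ?addr0 => [|j ji]; rewrite mxE ?eqxx ?scale1r //.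
by rewrite eq_sym (negbTE ji) scale0r.
Qed.

Lemma block_idem_entry (b : 'I_k) i j :
  block_idem C p b i j = ((i == j) && (blk i == b))%:R.
Proof.
rewrite /block_idem summxE.
have [/eqP ib|ib] := boolP (blk i == b); last first.
  rewrite andbF big1 // => r _; rewrite mxE.
  by case: eqP => // irb; rewrite irb /blk tagnat.Rank1K eqxx in ib.
rewrite andbT; subst b; rewrite (bigD1 (tagnat.sig2 i)) //= [X in _ + X]big1 ?addr0.
  by rewrite mxE tagnat.sig2K eqxx eq_sym.
move=> r ri; rewrite mxE; case: eqP => // irb; case/eqP: ri.
apply/val_inj/eqP; have := tagnat.eq_Rank r (tagnat.sig2 i).
by rewrite -irb tagnat.sig2K !eqxx => /esym.
Qed.

Lemma block_idem_mul (b : 'I_k) (Y : 'M[C]_(\sum_(i < k) p i)) i j :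
  (block_idem C p b *m Y *m block_idem C p b) i j =
  if (blk i == b) && (blk j == b) then Y i j else 0.
Proof.
rewrite mxE (bigD1 j) //= [X in _ + X]big1 ?addr0 => [|s sj]; last first.
  by rewrite block_idem_entry (negbTE sj) mulr0.
rewrite mxE (bigD1 i) //= [X in _ + X]big1 ?addr0 => [|s si]; last first.
  by rewrite block_idem_entry eq_sym (negbTE si) mul0r.
rewrite !block_idem_entry !eqxx /=.
by do 2!case: (_ == b); rewrite ?mul0r ?mul1r ?mulr1 ?mulr0.
Qed.

Lemma block_diagonal_entry X i j : block_diagonal X -> blk i != blk j -> X i j = 0.
Proof.
case=> Y -> ij; rewrite summxE big1 // => b _; rewrite block_idem_mul.
by case: andP => // -[/eqP ib /eqP jb]; rewrite ib jb eqxx in ij.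
Qed.

Lemma block_diagonal_idem i : block_diagonal (E i i).
Proof.
exists (fun _ => E i i); apply/matrixP=> s t; rewrite summxE.
rewrite (eq_bigr _ (fun b _ => block_idem_mul b _ s t)).
rewrite [RHS](bigD1 (blk s)) //= [X in _ + X]big1 ?addr0 => [|b bs]; last first.
  by rewrite eq_sym (negbTE bs).
rewrite eqxx /= /unit_mx leqnn mxE.
case: (s =P i) => [->|_]; last by case: ifP.
by case: (t =P i) => [->|_]; rewrite ?eqxx //; case: ifP.
Qed.

Lemma munit_ind (P : T -> Prop) :
  P 0 -> (forall c a b, P a -> P b -> P (c *: a + b)) ->
  (forall i j, P (E i j)) -> forall X, P X.
Proof.
move=> P0 PL PE X; rewrite [X]munit_sum.
have PD a b : P a -> P b -> P (a + b) by rewrite -{2}[a]scale1r; apply: PL.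
do 2!apply: (big_ind P) => // ? _.
by rewrite -[_ *: _]addr0; apply: PL.
Qed.

(** The product may vanish even when [j = s], when a factor is cut off
    to 0 although [E i t] is not. *)
Lemma munit_mul_or i j s t : E i j * E s t = 0 \/ j = s /\ E i j * E s t = E i t.
Proof.
have [<-|js] := eqVneq j s; last by left; rewrite munit_mul0.
have [ij|ij] := leqP (blk i) (blk j); last by left; rewrite (munit_gt ij) mul0r.
have [jt|jt] := leqP (blk j) (blk t); last by left; rewrite (munit_gt jt) mulr0.
by right; rewrite munit_mul.
Qed.

Lemma munit_idl i j : E i i * E i j = E i j.
Proof.
have [ij|ij] := leqP (blk i) (blk j); first by rewrite munit_mul.
by rewrite (munit_gt ij) mulr0.
Qed.

Lemma munit_idr i j : E i j * E j j = E i j.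
Proof.
have [ij|ij] := leqP (blk i) (blk j); first by rewrite munit_mul.
by rewrite (munit_gt ij) mul0r.
Qed.
End Units.

(** * Linear maps given by a proof of linearity *)

Section Linear.
Variables (R : pzRingType) (U V : lmodType R) (f : U -> V) (f_lin : linear f).
Let F : {linear U -> V} := HB.pack f (GRing.isLinear.Build _ _ _ _ f f_lin).
Lemma lin0 : f 0 = 0. Proof. exact: (linear0 F). Qed.
Lemma linD : {morph f : a b / a + b}. Proof. exact: (linearD F). Qed.
Lemma linB : {morph f : a b / a - b}. Proof. exact: (linearB F). Qed.
Lemma linZ c : {morph f : a / c *: a}. Proof. exact: (linearZ_LR F). Qed.
Lemma lin_sum I (r : seq I) (P : pred I) G :
  f (\sum_(i <- r | P i) G i) = \sum_(i <- r | P i) f (G i).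
Proof. exact: (linear_sum F). Qed.
End Linear.

(** * The Jordan identity on matrix units *)

Section Maps.
Variables (C : comPzRingType) (k : nat) (p : 'I_k -> nat) (M : bimodType C p).
Local Notation T := (blockTrig C p).
Local Notation I := 'I_(\sum_(i < k) p i).
Local Notation E := (munit C).
Implicit Types (i j l s t : I) (a b x y : T) (m : M) (c : C).

Lemma lact0l m : (0 : T) *L m = 0. Proof. exact: lin0 (lact_linearl m). Qed.
Lemma lact0r a : a *L (0 : M) = 0. Proof. exact: lin0 (lact_linearr a). Qed.
Lemma ract0l a : (0 : M) *R a = 0. Proof. exact: lin0 (ract_linearl a). Qed.
Lemma ract0r m : m *R (0 : T) = 0. Proof. exact: lin0 (ract_linearr m). Qed.

(** The terms are grouped so that, after multiplication by idempotents [g] and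
    [h], each of the four vanishes as soon as one product of units does. *)
Lemma jordan_corner (D : T -> M) g h x y : jordan_derivation D ->
  g *L D (x * y + y * x) *R h =
    g *L D x *R (y * h) + (g * x) *L D y *R h
    + (g *L D y *R (x * h) + (g * y) *L D x *R h).
Proof.
case=> _ ->; rewrite !(linD (lact_linearr g)) !(linD (ract_linearl h)).
by rewrite !lractA !ractA !lactA !addrA.
Qed.

Lemma derivation_munit (f : T -> M) : linear f ->
  (forall i j s t, f (E i j * E s t) = f (E i j) *R E s t + E i j *L f (E s t)) ->
  derivation f.
Proof.
move=> fL fE; split=> // a.
elim/munit_ind: a => [b|c a a' Ha Ha' b|i j].
- by rewrite mul0r (lin0 fL) ract0l lact0l addr0.
- rewrite mulrDl -blockTrig_scalerAl !fL Ha Ha' ract_linearl lact_linearl.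
  by rewrite scalerDr addrACA.
elim/munit_ind => [|c b b' Hb Hb'|s t]; last exact: fE.
  by rewrite mulr0 (lin0 fL) ract0r lact0r addr0.
rewrite mulrDr -blockTrig_scalerAr !fL Hb Hb' ract_linearr lact_linearr.
by rewrite scalerDr addrACA.
Qed.

Lemma antiderivation_munit (f : T -> M) : linear f ->
  (forall i j s t, f (E i j * E s t) = f (E s t) *R E i j + E s t *L f (E i j)) ->
  antiderivation f.
Proof.
move=> fL fE; split=> // a.
elim/munit_ind: a => [b|c a a' Ha Ha' b|i j].
- by rewrite mul0r (lin0 fL) ract0r lact0r addr0.
- rewrite mulrDl -blockTrig_scalerAl !fL Ha Ha' ract_linearr lact_linearr.
  by rewrite scalerDr addrACA.
elim/munit_ind => [|c b b' Hb Hb'|s t]; last exact: fE.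
  by rewrite mulr0 (lin0 fL) ract0l lact0l addr0.
rewrite mulrDr -blockTrig_scalerAr !fL Hb Hb' ract_linearl lact_linearl.
by rewrite scalerDr addrACA.
Qed.

(** * The antiderivation part *)

(** The component of [D (E i j)] on the wrong side: a derivation has its value
    at [E i j] in the corner (i, j), up to an inner derivation. *)
Definition swapped (D : T -> M) i j : M :=
  if i == j then 0 else E j j *L D (E i j) *R E i i.

Definition anti_part (D : T -> M) a : M :=
  \sum_i \sum_j (a : 'M__) i j *: swapped D i j.

Lemma anti_part_linear D : linear (anti_part D).
Proof.
move=> c a b; rewrite /anti_part scaler_sumr -big_split; apply: eq_bigr => i _.
rewrite scaler_sumr -big_split; apply: eq_bigr => j _.
by rewrite !mxE scalerDl scalerA.
Qed.

Lemma swapped_gt (D : T -> M) i j : linear D -> (blk j < blk i)%N -> swapped D i j = 0.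
Proof.
move=> DL ij; rewrite /swapped; case: ifP => // _.
by rewrite (munit_gt _ ij) (lin0 DL) lact0r ract0l.
Qed.

Lemma anti_part_munit D i j : linear D -> anti_part D (E i j) = swapped D i j.
Proof.
move=> DL; have [ij|ij] := leqP (blk i) (blk j); last first.
  rewrite swapped_gt // (munit_gt _ ij); exact: lin0 (anti_part_linear D).
rewrite /anti_part /= /unit_mx ij.
rewrite [LHS](bigD1 i) //= [X in _ + X]big1 ?addr0 => [|s si]; last first.
  by rewrite big1 // => t _; rewrite mxE (negbTE si) scale0r.
rewrite [LHS](bigD1 j) //= [X in _ + X]big1 ?addr0 => [|t tj]; last first.
  by rewrite mxE (negbTE tj) andbF scale0r.
by rewrite mxE !eqxx scale1r.
Qed.

Section Jordan.
Variables (M_tf : two_torsion_free M) (D : T -> M) (D_jordan : jordan_derivation D).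
Let DL : linear D := proj1 D_jordan.
Local Notation v := (swapped D).

(** Only [s = i] is not obvious. Then [E i j] and [E i l] have zero products in
    both orders, and the (l, j) corner of the Jordan identity leaves just
    [v i l *R E i j]; for [l = j] this term appears twice, whence the torsion
    hypothesis. *)
Lemma swapped_mulr_eq0 i j s l : i != j -> v s l *R E i j = 0.
Proof.
move=> ij; rewrite /swapped; case: eqP => [_|/eqP]; first by rewrite ract0l.
have [->|si _] := eqVneq s i; last by rewrite -ractA munit_mul0 ?ract0r.
move=> il.
have := jordan_corner (E l l) (E j j) (E i j) (E i l) D_jordan.
have [ji li] : j != i /\ l != i by rewrite eq_sym (eq_sym l).
rewrite !(munit_mul0 _ _ _ ji) !(munit_mul0 _ _ _ li).
rewrite addr0 (lin0 DL) lact0r !lact0l !ract0l !addr0 munit_idr.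
have [<-|lj] := eqVneq l j; last first.
  by rewrite (munit_mul0 _ _ _ lj) ract0r add0r -ractA munit_idl => <-.
by rewrite munit_idr => /esym/M_tf; rewrite -ractA munit_idl.
Qed.

(** Mirror image of [swapped_mulr_eq0], from the (l, i) corner of the identity
    at [E i j] and [E l j]. *)
Lemma swapped_mull_eq0 i j s l : l != j -> E l j *L v i s = 0.
Proof.
move=> lj; rewrite /swapped; case: eqP => [_|/eqP]; first by rewrite lact0r.
have [->|sj _] := eqVneq s j; last first.
  by rewrite -lractA -lactA munit_mul0 1?eq_sym // lact0l ract0l.
move=> ij.
have := jordan_corner (E l l) (E i i) (E i j) (E l j) D_jordan.
have [ji jl] : j != i /\ j != l by rewrite eq_sym (eq_sym j).
rewrite !(munit_mul0 _ _ _ ji) !(munit_mul0 _ _ _ jl).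
rewrite addr0 (lin0 DL) lact0r !ract0l !ract0r !add0r munit_idl.
have [<-|li] := eqVneq l i; last first.
  by rewrite (munit_mul0 _ _ _ li) lact0l ract0l add0r -lractA -lactA
    munit_idr lractA => <-.
by rewrite munit_idl => /esym/M_tf; rewrite -lractA -lactA munit_idr.
Qed.

(** In the Jordan identity at [E i j] and [E j l], no term on the right-hand
    side reaches the corner (l, i). *)
Lemma swapped_intermediate_eq0 i j l : i != j -> j != l ->
  (blk i <= blk j)%N -> (blk j <= blk l)%N -> v i l = 0.
Proof.
move=> ij jl bij bjl; rewrite /swapped; case: eqP => // /eqP il.
have := jordan_corner (E l l) (E i i) (E i j) (E j l) D_jordan.
have [li lj ji] : [/\ l != i, l != j & j != i] by split; rewrite eq_sym.
rewrite munit_mul // !(munit_mul0 _ _ _ li) !(munit_mul0 _ _ _ lj).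
rewrite !(munit_mul0 _ _ _ ji) addr0.
by rewrite !ract0r !lact0l !ract0l !addr0 => ->.
Qed.

(** Here [E j i] is a unit of the algebra, and multiplying
    [v i j *R E i j = 0] by it recovers [v i j]. *)
Lemma swapped_same_block_eq0 i j : blk i = blk j -> v i j = 0.
Proof.
move=> bij; have [ij|ij] := eqVneq i j; first by rewrite /swapped ij eqxx.
have := swapped_mulr_eq0 i j ij; rewrite {1}/swapped (negbTE ij) -ractA munit_idl => h.
rewrite /swapped (negbTE ij) -(@munit_mul C k p i j i) ?bij // ractA.
by rewrite h ract0l.
Qed.

Lemma antiderivation_anti_part : antiderivation (anti_part D).
Proof.
apply: antiderivation_munit; first exact: anti_part_linear.
have apE i j : anti_part D (E i j) = v i j by exact: anti_part_munit.
have ap0 : anti_part D 0 = 0 by exact: lin0 (anti_part_linear D).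
have v1 i : v i i = 0 by rewrite /swapped eqxx.
move=> i j s t; rewrite !apE.
(* A diagonal unit on one side acts on swapped values as an idempotent; for two
   off-diagonal units both sides of the identity vanish. *)
have [<-{j}|ij] := eqVneq i j.
  rewrite v1 lact0r addr0; have [<-{s}|si] := eqVneq i s.
    by rewrite munit_idl apE /swapped; case: ifP; rewrite ?ract0l // -ractA munit_idl.
  rewrite munit_mul0 // ap0 /swapped; case: ifP; rewrite ?ract0l // -ractA munit_mul0.
    by rewrite ract0r.
  by rewrite eq_sym.
have [<-{t}|st] := eqVneq s t.
  rewrite v1 ract0l add0r; have [<-{s}|js] := eqVneq j s.
    rewrite munit_idr apE /swapped; case: ifP; rewrite ?lact0r // => _.
    by rewrite -lractA -lactA munit_idl.
  rewrite munit_mul0 // ap0 /swapped; case: ifP; rewrite ?lact0r // -lractA -lactA.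
  rewrite munit_mul0; first by rewrite lact0l ract0l.
  by rewrite eq_sym.
rewrite swapped_mulr_eq0 // swapped_mull_eq0 // addr0.
have [js|js] := eqVneq j s; last by rewrite munit_mul0.
subst s; have [bij|bij] := leqP (blk i) (blk j); last by rewrite (munit_gt _ bij) mul0r.
have [bjt|bjt] := leqP (blk j) (blk t); last by rewrite (munit_gt _ bjt) mulr0.
by rewrite munit_mul // apE (swapped_intermediate_eq0 ij st).
Qed.

Lemma anti_part_block_diagonal X : block_diagonal X -> anti_part D X = 0.
Proof.
move=> dX; rewrite /anti_part big1 // => i _; rewrite big1 // => j _.
have [bij|bij] := eqVneq (blk i) (blk j).
  by rewrite swapped_same_block_eq0 ?scaler0.
by rewrite (block_diagonal_entry dX bij) scale0r.
Qed.
End Jordan.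

(** * The derivation part *)

Lemma derivation_jordan (d : T -> M) : derivation d -> jordan_derivation d.
Proof. by case=> dL dM; split=> // a b; rewrite (linD dL) !dM !addrA. Qed.

Lemma antiderivation_jordan (d : T -> M) : antiderivation d -> jordan_derivation d.
Proof.
by case=> dL dM; split=> // a b; rewrite (linD dL) !dM addrC !addrA.
Qed.

Lemma jordan_sub (f g : T -> M) : jordan_derivation f -> jordan_derivation g ->
  jordan_derivation (fun a => f a - g a).
Proof.
move=> [fL fJ] [gL gJ]; split=> [c a b|a b].
  by rewrite fL gL opprD addrACA scalerBr.
rewrite fJ gJ !(linB (lact_linearr _)) !(linB (ract_linearl _)) !opprD.
rewrite addrACA; congr (_ + _); rewrite addrACA; congr (_ + _).
exact: addrACA.
Qed.

Lemma derivation_add (f g : T -> M) : derivation f -> derivation g ->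
  derivation (fun a => f a + g a).
Proof.
move=> [fL fM] [gL gM]; split=> [c a b|a b].
  by rewrite fL gL addrACA scalerDr.
by rewrite fM gM (linD (lact_linearr _)) (linD (ract_linearl _)) addrACA.
Qed.

Lemma derivation_sub (f g : T -> M) : derivation f -> derivation g ->
  derivation (fun a => f a - g a).
Proof.
move=> [fL fM] [gL gM]; split=> [c a b|a b].
  by rewrite fL gL opprD addrACA scalerBr.
by rewrite fM gM (linB (lact_linearr _)) (linB (ract_linearl _)) opprD addrACA.
Qed.

Lemma antiderivation_sub (f g : T -> M) : antiderivation f -> antiderivation g ->
  antiderivation (fun a => f a - g a).
Proof.
move=> [fL fM] [gL gM]; split=> [c a b|a b].
  by rewrite fL gL opprD addrACA scalerBr.
by rewrite fM gM (linB (lact_linearr _)) (linB (ract_linearl _)) opprD addrACA.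
Qed.

Definition inner m a : M := m *R a - a *L m.

Lemma inner_derivation m : derivation (inner m).
Proof.
rewrite /inner; split=> [c a b|a b].
  by rewrite ract_linearr lact_linearl opprD addrACA scalerBr.
rewrite (linB (lact_linearr _)) (linB (ract_linearl _)) ractA lactA lractA.
by rewrite addrA subrK.
Qed.

(** In the Jordan identity at [E i j] and [E s t], the terms of the derivation
    identity for [E i j * E s t] lie in the corner (i, t), those for
    [E s t * E i j] in (s, j). If the corners differ, cutting to (i, t) separates
    the two; if they agree, then the units are equal and the identity is twice
    the desired one. *)
Lemma derivation_of_corner (f : T -> M) :
  two_torsion_free M -> jordan_derivation f ->
  (forall i j, f (E i j) = E i i *L f (E i j) *R E j j) -> derivation f.
Proof.
move=> M_tf fJ fE; have fL := proj1 fJ; apply: derivation_munit => // i j s t.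
have f0 : f 0 = 0 := lin0 fL.
have fl i' j' : E i' i' *L f (E i' j') = f (E i' j').
  by rewrite fE -lractA -lactA munit_idl.
have fr i' j' : f (E i' j') *R E j' j' = f (E i' j').
  by rewrite fE -ractA munit_idr.
have fl0 i' s' j' : i' != s' -> E i' i' *L f (E s' j') = 0.
  by move=> ne; rewrite -fl -lactA munit_mul0 // lact0l.
have fr0 i' s' j' : j' != s' -> f (E i' j') *R E s' s' = 0.
  by move=> ne; rewrite -fr -ractA munit_mul0 // ract0r.
have [ist|ne] := eqVneq (i, j) (s, t).
  case: ist => <- <-; apply/subr0_eq/M_tf; rewrite mulrnBl.
  have := proj2 fJ (E i j) (E i j).
  by rewrite (linD fL) -addrA -!mulr2n => ->; rewrite subrr.
have {}ne : i != s \/ j != t.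
  by apply/orP; rewrite -negb_and -xpair_eqE.
have := jordan_corner (E i i) (E t t) (E i j) (E s t) fJ.
rewrite (linD fL) (linD (lact_linearr _)) (linD (ract_linearl _)).
have -> : E i i *L f (E i j * E s t) *R E t t = f (E i j * E s t).
  by case: (munit_mul_or C i j s t) => [|[_]] ->; rewrite ?f0 ?lact0r ?ract0l // fl fr.
have -> : E i i *L f (E s t * E i j) *R E t t = 0.
  case: (munit_mul_or C s t i j) => [|[_]] ->; first by rewrite f0 lact0r ract0l.
  by case: ne => ?; [rewrite fl0 ?ract0l | rewrite lractA fr0 ?lact0r].
have -> : E i i *L f (E s t) *R (E i j * E t t) = 0.
  case: ne => ?; first by rewrite fl0 ?ract0l.
  by rewrite munit_mul0 ?ract0r.
have -> : (E i i * E s t) *L f (E i j) *R E t t = 0.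
  case: ne => ?; first by rewrite munit_mul0 ?lact0l ?ract0l.
  by rewrite lractA fr0 ?lact0r.
by rewrite munit_idr munit_idl fl lractA fr !addr0.
Qed.

Section Normalize.
Variables (M_unital : unital_bimodule M) (M_tf : two_torsion_free M).

(** For orthogonal [E i i] and [E j j] the Jordan identity makes the (j, i)
    corners of [f (E i i)] and [f (E j j)] opposite to each other. So the sum over
    [i] of [f (E i i) *R E i i] implements [f] on all the idempotents at once. *)
Lemma jordan_inner_idem (f : T -> M) : jordan_derivation f ->
  exists m, forall j, f (E j j) = inner m (E j j).
Proof.
move=> fJ; have fL := proj1 fJ.
have fe j : f (E j j) = f (E j j) *R E j j + E j j *L f (E j j).
  apply/subr0_eq/M_tf; rewrite mulrnBl.
  have := proj2 fJ (E j j) (E j j).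
  by rewrite (linD fL) -addrA -!mulr2n !munit_idl => ->; rewrite subrr.
have fjj j : E j j *L f (E j j) *R E j j = 0.
  apply: (@addrI _ (f (E j j) *R E j j)).
  rewrite addr0; have /(congr1 (fun m => m *R E j j)) := fe j.
  by rewrite (linD (ract_linearl _)) -ractA munit_idl => <-.
have fij i j : i != j -> E j j *L f (E i i) *R E i i = - (E j j *L f (E j j) *R E i i).
  move=> ij; apply/eqP; rewrite -addr_eq0; apply/eqP.
  have ji : j != i by rewrite eq_sym.
  have := jordan_corner (E j j) (E i i) (E i i) (E j j) fJ.
  rewrite !(munit_mul0 _ _ _ ij) !(munit_mul0 _ _ _ ji) addr0 (lin0 fL) !munit_idl.
  by rewrite lact0r !lact0l !ract0r !ract0l !add0r addrC => <-.
exists (\sum_i f (E i i) *R E i i) => j; rewrite /inner.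
(* The commutator is f(e_j) e_j minus the sum of the e_j f(e_i) e_i, and [fij]
   turns the latter into e_j f(e_j) times 1 - e_j. *)
rewrite (lin_sum (ract_linearl _)) (lin_sum (lact_linearr _)).
rewrite (bigD1 j) //= [X in _ + X - _]big1 ?addr0 => [|i ij]; last first.
  by rewrite -ractA munit_mul0 ?ract0r.
rewrite -ractA munit_idl (bigD1 j) //= -lractA fjj add0r.
rewrite (eq_bigr (fun i => - (E j j *L f (E j j) *R E i i))) => [|i ij]; last first.
  by rewrite -lractA fij.
rewrite sumrN opprK {1}fe; congr (_ + _).
rewrite -{1}[E j j *L f (E j j)](proj2 (M_unital _)) -sum_munit1.
by rewrite (lin_sum (ract_linearr _)) (bigD1 j) //= fjj add0r.
Qed.

(** An inner derivation has no swapped component either, so the hypothesis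
    survives the normalization that kills the idempotents. After it, [E i j]
    being fixed by [E i i] and [E j j] puts its image in the corners (i, j) and
    (j, i), and the second is excluded. *)
Lemma derivation_of_no_swap (f : T -> M) : jordan_derivation f ->
  (forall i j, i != j -> E j j *L f (E i j) *R E i i = 0) -> derivation f.
Proof.
move=> fJ f0; have [m fm] := jordan_inner_idem fJ.
pose g a := f a - inner m a.
have fg a : f a = g a + inner m a by rewrite /g subrK.
have gJ : jordan_derivation g.
  exact: jordan_sub fJ (derivation_jordan (inner_derivation m)).
suff [gD gM] : derivation g.
  have [dL dM] := derivation_add (conj gD gM) (inner_derivation m).
  by split=> [c a b|a b]; rewrite !fg ?dL ?dM.
apply: derivation_of_corner => // i j.
have ge s : g (E s s) = 0 by rewrite /g fm subrr.
have [<-|ij] := eqVneq i j; first by rewrite ge lact0r ract0l.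
have ji : j != i by rewrite eq_sym.
have gl : g (E i j) = g (E i j) *R E i i + E i i *L g (E i j).
  have := proj2 gJ (E i i) (E i j).
  by rewrite munit_idl munit_mul0 // addr0 ge ract0l lact0r add0r addr0 addrC.
have gr : g (E i j) = g (E i j) *R E j j + E j j *L g (E i j).
  have := proj2 gJ (E i j) (E j j).
  by rewrite munit_idr munit_mul0 // addr0 ge ract0l lact0r !addr0.
have gji : E j j *L g (E i j) *R E i i = 0.
  rewrite /g (linB (lact_linearr _)) (linB (ract_linearl _)) f0 // /inner.
  rewrite (linB (lact_linearr _)) (linB (ract_linearl _)) -!lractA -!ractA -!lactA.
  by rewrite !(munit_mul0 _ _ _ ji) lact0l ract0r ract0l !subr0.
have gij : E i i *L g (E i j) = E i i *L g (E i j) *R E j j.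
  rewrite {1}gr (linD (lact_linearr _)) -lactA munit_mul0 // lact0l addr0.
  by rewrite lractA.
have gii : g (E i j) *R E i i = 0.
  by rewrite gr (linD (ract_linearl _)) -ractA munit_mul0 // ract0r add0r gji.
by rewrite -gij {1}gl gii add0r.
Qed.

End Normalize.

(** * Uniqueness and the decomposition *)

Lemma derivation_antiderivation_eq0 (d h : T -> M) : derivation d -> antiderivation h ->
  d =1 h -> (forall i, h (E i i) = 0) -> h =1 fun _ => 0.
Proof.
move=> [dL dM] [hL hM] dh h0 X; rewrite [X]munit_sum (lin_sum hL) big1 // => i _.
rewrite (lin_sum hL) big1 // => j _; rewrite (linZ hL).
have [<-|ij] := eqVneq i j; first by rewrite h0 scaler0.
suff -> : h (E i j) = 0 by rewrite scaler0.
have hl : h (E i j) = h (E i j) *R E i i.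
  by rewrite -{1}(munit_idl C i j) hM h0 lact0r addr0.
rewrite -{1}(munit_idr C i j) -dh dM !dh h0 lact0r addr0 hl -ractA munit_mul0 //.
exact: ract0r.
Qed.

End Maps.

Theorem theorem3p2 (C : comPzRingType) (k : nat) (p : 'I_k -> nat)
  (k_gt0 : (0 < k)%N) (p_gt0 : forall i : 'I_k, (0 < p i)%N)
  (M : bimodType C p)
  (M_unital : unital_bimodule M) (M_tf : two_torsion_free M)
  (D : blockTrig C p -> M) (D_jordan : jordan_derivation D) :
  let decomposes (d alpha : blockTrig C p -> M) :=
    [/\ derivation d, antiderivation alpha,
        forall X, D X = d X + alpha X
      & forall X, block_diagonal X -> alpha X = 0] in
  (exists d alpha, decomposes d alpha) /\
  (forall d alpha d' alpha', decomposes d alpha -> decomposes d' alpha' ->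
     d =1 d' /\ alpha =1 alpha').
Proof.
split.
  have ap := antiderivation_anti_part M_tf D_jordan.
  exists (fun X => D X - anti_part D X), (anti_part D); split=> //.
  - have dJ := jordan_sub D_jordan (antiderivation_jordan ap).
    apply: (derivation_of_no_swap M_unital M_tf dJ) => i j ij.
    rewrite anti_part_munit; last exact: proj1 D_jordan.
    rewrite /swapped (negbTE ij) (linB (lact_linearr _)) (linB (ract_linearl _)).
    by rewrite !lractA -ractA -lactA !munit_idl subrr.
  - by move=> X; rewrite subrK.
  - by move=> X; apply: anti_part_block_diagonal.
move=> d h d' h' [dD hA Dh h0] [d'D h'A Dh' h'0].
have dh X : d' X - d X = h X - h' X.
  by apply/eqP; rewrite subr_eq addrAC [h X + _]addrC -Dh Dh' addrK.
have hh' : h =1 h'.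
  move=> X; apply/subr0_eq.
  apply: (derivation_antiderivation_eq0 (derivation_sub d'D dD) _ dh).
    exact: antiderivation_sub.
  by move=> i; rewrite h0 ?h'0 ?subrr //; apply: block_diagonal_idem.
by split=> // X; move: (Dh X); rewrite Dh' -hh' => /addIr.
Qed.
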